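(* Let $\mathbb{G}=(\mathbb{N},\mathbb{E})$, $\mathbb{N}=\{1,\dots,N\}$, be an undirected connected graph with neighbour sets $\mathbb{N}_i=\{j : \{i,j\}\in\mathbb{E}\}$. Let $f:\mathbb{R}\to\mathbb{R}$ be strictly increasing, odd and bounded, and let $h:\mathbb{R}\to\mathbb{R}$ be strictly increasing. Let $\{n_{ij}(t)\}$ (indexed by $t\in\{0,1,2,\dots\}$ and ordered pairs $(i,j)$ with $\{i,j\}\in\mathbb{E}$) be mutually independent, identically distributed real random variables whose common distribution is symmetric about zero. Let $\alpha(t)>0$ satisfy $\sum_{t\ge 0}\alpha(t)=\infty$ and $\sum_{t\ge 0}\alpha^2(t)<\infty$. Let $\mathbf{X}(t)=[x_1(t),\dots,x_N(t)]^{\mathrm T}$ be the process with initial state $\mathbf{X}(0)\in\mathbb{R}^N$ and $$x_i(t+1)=x_i(t)-\alpha(t)\sum_{j\in\mathbb{N}_i} f\bigl(h(x_i(t))-h(x_j(t))-n_{ij}(t)\bigr),\qquad i=1,\dots,N,\ t\ge 0.$$ Then there exists a finite real random variable $\theta^*$ such that $$\Pr\Bigl[\lim_{t\to\infty}\mathbf{X}(t)=\theta^*\mathbf{1}\Bigr]=1 .$$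
   Context: $\mathbf{1}=[1,\dots,1]^{\mathrm T}\in\mathbb{R}^N$. The graph is simple. The initial state $\mathbf{X}(0)$ is a fixed (deterministic) vector. No moment assumptions are made on the noise $n_{ij}(t)$. *)

(* Defs.v *)
From HB Require Import structures.
From mathcomp Require Export all_boot all_order all_algebra.
From mathcomp Require Export finmap.
From mathcomp Require Export all_classical all_reals all_analysis.
Export Order.TTheory GRing.Theory Num.Theory.
Export numFieldNormedType.Exports.

Set Implicit Arguments.
Unset Strict Implicit.
Unset Printing Implicit Defensive.

Local Open Scope classical_set_scope.
Local Open Scope ring_scope.

(* Vertices are 0, ..., N-1 (instead of 1, ..., N); [e i j] means {i, j} is an
   edge. *)
Definition simple_graph (N : nat) (e : rel 'I_N) : Prop :=
  symmetric e /\ irreflexive e.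

Definition connected_graph (N : nat) (e : rel 'I_N) : Prop :=
  (0 < N)%N /\ forall i j : 'I_N, connect e i j.

Definition neighbours (N : nat) (e : rel 'I_N) (i : 'I_N) : {set 'I_N} :=
  [set j | e i j]%SET.

Section RandomVariables.
Context {d : measure_display} {T : measurableType d} {R : realType}.
Variables (P : probability T R) (I : choiceType).

(* In the next two definitions only the variables [X i] with [i] in [D] are
   constrained. *)
Definition mutually_independent (D : set I) (X : I -> {RV P >-> R}) : Prop :=
  forall J : {fset I}, [set` J] `<=` D ->
  forall A : I -> set R, (forall i, i \in J -> measurable (A i)) ->
    P (\bigcap_(i in [set` J]) (X i @^-1` A i)) =
    (\prod_(i <- J) P (X i @^-1` A i))%E.

Definition identically_distributed (D : set I) (X : I -> {RV P >-> R}) : Prop :=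
  forall i j : I, D i -> D j -> forall A : set R, measurable A ->
    distribution P (X i) A = distribution P (X j) A.

End RandomVariables.

Definition symmetric_law (R : realType) (mu : set R -> \bar R) : Prop :=
  forall A : set R, measurable A -> mu [set - x | x in A] = mu A.

(* Main.v *)
Require Import Defs.
From mathcomp Require Import lra ring measurable_realfun.

Set Implicit Arguments.
Unset Strict Implicit.

(* Averaging [f] over the noise gives [g c := E f(c - n)], which is odd,
   nondecreasing and positive on positive reals.  Hence
   [x(t+1) = x(t) - alpha(t) * G(x(t)) + v(t)], where
   [G_i(x) = \sum_j g(h(x_i) - h(x_j))] and the [v(t)] are [alpha(t)] times bounded
   martingale differences; since [alpha] is square summable, the series of the
   [v(t)] converges almost surely.  The rest is pathwise: subtracting the tail
   of that series leaves [y(t+1) = y(t) - alpha(t) * G(y(t) - r(t))] with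
   [r(t) --> 0]; the sum of the [y_i] is conserved, so after a shift it is 0, and
   the energy [\sum_i y_i^2] decreases, up to [o(alpha(t))], by a multiple of
   [alpha(t)] as long as it is not small.  That multiple is uniform although [y]
   is not known to be bounded and [h] may flatten at infinity: a non-small
   balanced [y] takes values on both sides of a fixed interval around 0, so
   connectedness gives an edge across a definite part of that interval. *)

Local Open Scope classical_set_scope.
Local Open Scope ring_scope.

(** * Deterministic consensus *)

(** [h] may jump, so compactness gives no minimum. Instead steps of length [k / 2] cover the
    interval: for [s] in [[p, p + k / 2]] monotonicity bounds the increment below by
    [h (p + k) - h (p + k / 2)]. *)
Lemma increment_lower_bound (R : realType) (h : R -> R) (a b k : R) :
  {homo h : x y / x < y} -> 0 < k ->
  exists2 c, 0 < c & forall s, a <= s <= b -> c <= h (s + k) - h s.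
Proof.
move=> h_incr k0.
have h_mono x y : x <= y -> h x <= h y.
  by rewrite le_eqVlt => /predU1P[->//|/h_incr/ltW].
have step (m : nat) : exists2 c, 0 < c &
    forall s, a <= s <= a + m%:R * (k / 2) -> c <= h (s + k) - h s.
  elim: m => [|m [c c0 IH]].
    exists (h (a + k) - h a); first by rewrite subr_gt0; apply: h_incr; lra.
    by move=> s; rewrite mul0r addr0 => /le_anti ->.
  pose p := a + m%:R * (k / 2).
  exists (Num.min c (h (p + k) - h (p + k / 2))).
    by rewrite lt_min c0 subr_gt0 h_incr// ltrD2l; lra.
  move=> s; rewrite -natr1 mulrDl mul1r addrA -/p => /andP[sa sp].
  rewrite ge_min; case: (leP s p) => [sp'|ps]; first by rewrite IH// sa.
  by apply/orP; right; apply: lerB; apply: h_mono; lra.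
have [m Hm] : exists m : nat, (b - a) / (k / 2) < m%:R.
  exists (Num.bound `|(b - a) / (k / 2)|).
  exact: le_lt_trans (ler_norm _) (archi_boundP (normr_ge0 _)).
have [c c0 H] := step m; exists c => // s /andP[sa sb].
apply: H; rewrite sa/=; move: Hm; rewrite ltr_pdivrMr; lra.
Qed.

Lemma perturbed_descent_cvg0 (R : realType) (V a : nat -> R) :
  (forall t, 0 <= V t) -> (forall t, 0 < a t) ->
  (\sum_(0 <= t <oo) (a t)%:E = +oo)%E -> a @ \oo --> 0 ->
  (forall b, 0 < b -> \forall t \near \oo, V t.+1 <= V t + a t * b) ->
  (forall b, 0 < b -> exists2 c, 0 < c &
    \forall t \near \oo, b <= V t -> V t.+1 <= V t - a t * c) ->
  V @ \oo --> 0.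
Proof.
move=> V0 a0 adiv acvg up down; apply/cvgrPdist_le => _/posnumP[b].
have b2 : 0 < b%:num / 2 by [].
have [c c0 [T1 _ HT1]] := down _ b2.
have [T2 _ HT2] := up _ b2.
move/cvgrPdist_lt : acvg => /(_ 1 ltr01)[T3 _ HT3].
pose T0 := maxn T1 (maxn T2 T3).
have [t1 T0t1 Vt1] : exists2 t1, (T0 <= t1)%N & V t1 < b%:num / 2.
  apply: contrapT => /forall2NP nV.
  (* If [V] stayed above [b / 2] from [T0] on, the descents would add up and bound the partial sums
     of [a], against divergence. *)
  have Vdec n : V (T0 + n)%N <= V T0 - c * \sum_(T0 <= t < T0 + n) a t.
    elim: n => [|n IH]; first by rewrite addn0 big_geq// mulr0 subr0.
    rewrite addnS big_nat_recr ?leq_addr//=.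
    have Tn : (T0 <= T0 + n)%N by rewrite leq_addr.
    have := HT1 (T0 + n)%N; rewrite /= (leq_trans _ Tn) ?leq_maxl// => /(_ isT).
    case: (nV (T0 + n)%N) => [/(_ Tn)//|/negP]; rewrite -leNgt => Vn /(_ Vn).
    lra.
  have : (\sum_(0 <= t <oo) (a t)%:E <= (\sum_(0 <= t < T0) a t + V T0 / c)%:E)%E.
    apply: lime_le; first by apply: is_cvg_nneseries => *; rewrite lee_fin ltW.
    near=> n; have Tn : (T0 <= n)%N by near: n; exact: nbhs_infty_ge.
    rewrite sumEFin lee_fin (big_cat_nat _ Tn)//= lerD2l ler_pdivlMr// mulrC.
    by have := Vdec (n - T0)%N; rewrite subnKC//; have := V0 n; lra.
  by rewrite adiv leNgt ltry.
exists t1 => // t /= t1t; rewrite sub0r normrN ger0_norm//.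
(* After [t1] the bound [V <= b] persists: from [b / 2] upwards [V] decreases, and a step from below
   adds less than [b / 2] because [a < 1]. *)
suff : V (t1 + (t - t1))%N <= b%:num by rewrite subnKC.
elim: (t - t1)%N => [|n IH]; first by rewrite addn0; lra.
rewrite addnS.
have Tn : (T0 <= t1 + n)%N by rewrite (leq_trans T0t1)// leq_addr.
have := a0 (t1 + n)%N => a0n.
case: (leP (b%:num / 2) (V (t1 + n)%N)) => Vn.
  have := HT1 (t1 + n)%N; rewrite /= (leq_trans _ Tn) ?leq_maxl// => /(_ isT Vn).
  have := mulr_gt0 a0n c0; lra.
have := HT2 (t1 + n)%N; rewrite /= (leq_trans _ Tn)  ?leq_max ?leqnn ?orbT// => /(_ isT).
have := HT3 (t1 + n)%N; rewrite /= (leq_trans _ Tn)  ?leq_max ?leqnn ?orbT// => /(_ isT).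
rewrite sub0r normrN gtr0_norm// => a1.
have : a (t1 + n)%N * (b%:num / 2) <= 1 * (b%:num / 2) by rewrite ler_wpM2r// ltW.
lra.
Unshelve. all: by end_near. Qed.

(** A path without repeated vertices has fewer than [N] edges; with drops below [k] on all of them
    the total would stay below [N * k]. *)
Lemma connected_gap_edge (R : realType) (N : nat) (e : rel 'I_N) (z : 'I_N -> R)
    (a b : 'I_N) (k : R) :
  connected_graph e -> 0 < k -> N%:R * k <= z a - z b ->
  exists u v, e u v /\ k <= z u - z v.
Proof.
move=> [_ /(_ a b)/connectP[p0 /shortenP[p ep up _] ->]] k0 {p0} gap.
apply: contrapT => nP.
have small u v : e u v -> z u - z v <= k.
  by move=> euv; rewrite leNgt; apply/negP => /ltW kuv; apply: nP; exists u, v.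
have {gap} : N%:R * k <= (size p)%:R * k.
  apply: le_trans gap _; elim: p a ep {up} => [|c p IH] a /=.
    by rewrite subrr mul0r.
  move=> /andP[/small eac /IH]; rewrite -natr1; lra.
rewrite ler_pM2r// ler_nat leqNgt.
by have := card_uniqP up; rewrite /= => <-; rewrite -[X in (_ <= X)%N](card_ord N) max_card.
Qed.

(** Otherwise all [y j + k] are positive, so [y i + k] is at most their sum [N * k], which is too
    small. *)
Lemma balanced_low (R : realType) (N : nat) (y : 'I_N -> R) (i : 'I_N) (k : R) :
  \sum_j y j = 0 -> N%:R * k <= y i -> 0 < k -> exists j, y j <= - k.
Proof.
move=> y0 yi k0; apply: contrapT => /forallNP nP.
have yk j : 0 < y j + k by have /negP := nP j; rewrite -ltNge; lra.
have : y i + k <= \sum_j (y j + k).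
  by rewrite (bigD1 i)//= lerDl sumr_ge0// => j _; exact: ltW.
by rewrite big_split/= y0 add0r sumr_const card_ord -mulr_natl; lra.
Qed.

Lemma balanced_spread (R : realType) (N : nat) (y : 'I_N -> R) (i : 'I_N) (k : R) :
  \sum_j y j = 0 -> N%:R * k <= `|y i| -> 0 < k ->
  exists a b, k <= y a /\ y b <= - k.
Proof.
move=> y0 yi k0.
have N1 : 1 <= N%:R :> R by rewrite ler1n; case: (N) i {yi} => [[]|].
have kN : k <= N%:R * k by rewrite ler_peMl// ltW.
have [yi0|yi0] := leP 0 (y i); move: yi.
  rewrite ger0_norm// => yi; have [j yj] := balanced_low y0 yi k0.
  by exists i, j; split=> //; lra.
rewrite ltr0_norm// => yi.
have [|j yj] := @balanced_low _ _ (fun j => - y j) i k _ yi k0.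
  by rewrite sumrN y0 oppr0.
by exists j, i; split; lra.
Qed.

(** The constants must not depend on [y], which may be arbitrarily large. Clipping [y] to a fixed
    interval brings the search for a good edge to a range where [h] has a uniform increment. *)
Lemma consensus_gain (R : realType) (N : nat) (e : rel 'I_N) (g h : R -> R) (dl : R) :
  connected_graph e -> {homo g : x y / x <= y} -> (forall x, 0 < x -> 0 < g x) ->
  {homo h : x y / x < y} -> 0 < dl ->
  exists2 c, 0 < c & exists2 k, 0 < k & forall y r : 'I_N -> R,
    \sum_i y i = 0 -> (exists i, dl <= `|y i|) -> (forall i, `|r i| <= k) ->
    exists u v, e u v /\
      c <= (y u - y v) * g (h (y u - r u) - h (y v - r v)).
Proof.
move=> e_conn g_mono g_pos h_incr dl0.
have h_mono x y : x <= y -> h x <= h y.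
  by rewrite le_eqVlt => /predU1P[->//|/h_incr/ltW].
have N0 : 0 < N%:R :> R by rewrite ltr0n; case: e_conn.
pose eta := dl / N%:R; have eta0 : 0 < eta by rewrite divr_gt0.
(* [4 * k] is the width [2 * eta] divided by [N]: half of it absorbs the perturbations at both ends,
   the other half feeds the increment of [h]. *)
pose k := (eta + eta) / N%:R / 4.
have k0 : 0 < k by rewrite !divr_gt0// addr_gt0.
have [q q0 Hq] := @increment_lower_bound R h (- eta) (eta + k) (2 * k) h_incr ltac:(lra).
exists (4 * k * g q); first by apply: mulr_gt0; [lra|exact: g_pos].
exists k => // y r y0 [i yi] rk.
have [a [b [ya yb]]] : exists a b, eta <= y a /\ y b <= - eta.
  by apply: (balanced_spread y0 (i := i)) => //; rewrite mulrC divfK// gt_eqF.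
pose z j := Num.max (- eta) (Num.min eta (y j)).
have zE j : z j = - eta /\ y j <= - eta \/ z j = eta /\ eta <= y j \/
    z j = y j /\ - eta <= y j <= eta.
  rewrite /z; case: (leP eta (y j)) => y1.
    by right; left; rewrite max_r//; lra.
  case: (leP (- eta) (y j)) => y2; last by left; split=> //; exact: ltW.
  by right; right; split=> //; exact: ltW.
have [u [v [euv zuv]]] : exists u v, e u v /\ 4 * k <= z u - z v.
  apply: (connected_gap_edge (a := a) (b := b) e_conn); first lra.
  rewrite /k [4 * _]mulrC divfK ?pnatr_eq0// mulrC divfK ?gt_eqF//.
  by have := zE a; have := zE b; lra.
exists u, v; split=> //.
have /andP[zv1 zv2] : - eta <= z v <= eta by have := zE v; lra.
(* As [z u > z v], the value at [u] was not raised to [- eta] and that at [v] not lowered to [eta];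
   clipping only shrank the gap. *)
have /andP[yu yv] : (z u <= y u) && (y v <= z v) by have := zE u; have := zE v; lra.
have := rk u; have := rk v; rewrite !ler_norml => /andP[rv1 rv2] /andP[ru1 ru2].
have hq : q <= h (y u - r u) - h (y v - r v).
  apply: le_trans (Hq (z v + k) _) _; first lra.
  by apply: lerB; apply: h_mono; lra.
by apply: ler_pM; [lra|exact/ltW/g_pos|lra|exact: g_mono].
Qed.

(** The product is negative only if the perturbation reverses the order of the two ends; by
    monotonicity of [h] their distance is then at most [2 * rho]. *)
Lemma edge_term_ge (R : realType) (g h : R -> R) (K rho yu yv ru rv : R) :
  {homo g : x y / x <= y} -> g 0 = 0 -> (forall x, `|g x| <= K) ->
  {homo h : x y / x < y} -> `|ru| <= rho -> `|rv| <= rho ->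
  - (2 * rho * K) <= (yu - yv) * g (h (yu - ru) - h (yv - rv)).
Proof.
move=> g_mono g0 gK h_incr; rewrite !ler_norml => /andP[? ?] /andP[? ?].
have h_mono x y : x <= y -> h x <= h y.
  by rewrite le_eqVlt => /predU1P[->//|/h_incr/ltW].
set q := h _ - h _; have := gK q; rewrite ler_norml => /andP[gq1 gq2].
have K0 : 0 <= K by exact: le_trans (gK 0).
have rK : 0 <= rho * K by rewrite mulr_ge0//; lra.
have [q0|q0] := leP 0 q.
  have gq : 0 <= g q by rewrite -g0; exact: g_mono.
  have [d0|d0] := leP 0 (yu - yv).
    by have := mulr_ge0 d0 gq; lra.
  have : yv - rv <= yu - ru.
    by rewrite leNgt; apply/negP => /h_incr; move: q0; rewrite /q; lra.
  move=> d1; have : (yv - yu) * g q <= (2 * rho) * K by apply: ler_pM; lra.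
  lra.
have gq : g q <= 0 by rewrite -g0; exact/g_mono/ltW.
have [d0|d0] := leP (yu - yv) 0.
  by have := mulr_le0 d0 gq; lra.
have : yu - ru <= yv - rv.
  by rewrite leNgt; apply/negP => /h_incr; move: q0; rewrite /q; lra.
move=> d1; have : (yu - yv) * - g q <= (2 * rho) * K by apply: ler_pM; lra.
lra.
Qed.

(** By antisymmetry both ends of an edge contribute equally to the double sum, which accounts for
    the factor 2 of the cross term. *)
Lemma energy_step (R : realType) (N : nat) (e : rel 'I_N) (y : 'I_N -> R)
    (w : 'I_N -> 'I_N -> R) (a : R) :
  symmetric e -> (forall i j, w j i = - w i j) ->
  \sum_i (y i - a * \sum_(j | e i j) w i j) ^+ 2 =
  \sum_i y i ^+ 2 - a * (\sum_i \sum_(j | e i j) (y i - y j) * w i j)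
   + a ^+ 2 * \sum_i (\sum_(j | e i j) w i j) ^+ 2.
Proof.
move=> e_sym w_anti.
have -> : \sum_i \sum_(j | e i j) (y i - y j) * w i j =
    2 * \sum_i y i * \sum_(j | e i j) w i j.
  transitivity (\sum_i \sum_(j | e i j) y i * w i j + \sum_i \sum_(j | e i j) y j * w j i).
    rewrite -big_split/=; apply: eq_bigr => i _; rewrite -big_split/=.
    by apply: eq_bigr => j _; rewrite w_anti; ring.
  rewrite [X in _ + X](exchange_big_dep predT)//=.
  rewrite [in LHS](eq_bigr (fun i => y i * \sum_(j | e i j) w i j)) => [|i _]; last first.
    by rewrite mulr_sumr.
  rewrite [X in _ + X](eq_bigr (fun i => y i * \sum_(j | e i j) w i j)) => [|i _]; last first.
    by rewrite mulr_sumr; apply: eq_bigl => j; rewrite e_sym.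
  ring.
rewrite !mulr_sumr -sumrB -big_split/=; apply: eq_bigr => i _; ring.
Qed.

(** Exchanging [i] and [j] negates the sum. This is what conserves the total of the states. *)
Lemma sum_flow_eq0 (R : realType) (N : nat) (e : rel 'I_N) (w : 'I_N -> 'I_N -> R) :
  symmetric e -> (forall i j, w j i = - w i j) ->
  \sum_i \sum_(j | e i j) w i j = 0.
Proof.
move=> e_sym w_anti; set s := LHS.
suff : s = - s by lra.
rewrite {1}/s (exchange_big_dep predT)//= -sumrN; apply: eq_bigr => i _.
rewrite -sumrN; apply: eq_big => [j|j _]; first exact: e_sym.
by rewrite w_anti.
Qed.

Lemma edge_sum_ge (R : realType) (N : nat) (e : rel 'I_N) (F : 'I_N -> 'I_N -> R)
    (m : R) :
  0 <= m -> (forall i j, - m <= F i j) ->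
  - (N%:R * N%:R * m) <= \sum_i \sum_(j | e i j) F i j /\
  forall u v c, e u v -> c <= F u v ->
    c - N%:R * N%:R * m <= \sum_i \sum_(j | e i j) F i j.
Proof.
move=> m0 Fm.
pose G (p : 'I_N * 'I_N) := (if e p.1 p.2 then F p.1 p.2 else 0) + m.
have G0 p : 0 <= G p.
  by rewrite /G; case: ifP => _; [have := Fm p.1 p.2; lra|lra].
have -> : \sum_i \sum_(j | e i j) F i j = \sum_p G p - N%:R * N%:R * m.
  rewrite pair_big_dep/= big_split/= sumr_const card_prod card_ord -[m *+ _]mulr_natl.
  by rewrite natrM addrK [in RHS]big_mkcond/= [in LHS]big_mkcond.
split=> [|u v c euv cF].
  by rewrite lerBrDl subrr sumr_ge0.
rewrite lerD2r (bigD1 (u, v))//= {1}/G/= euv.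
have : 0 <= \sum_(p | p != (u, v)) G p by rewrite sumr_ge0.
lra.
Qed.

(** The energy [V] meets the conditions of [perturbed_descent_cvg0]: a small [r] limits what all
    edges together can lose, and when [V] is not small the edge from [consensus_gain] outweighs
    this. *)
Lemma balanced_consensus (R : realType) (N : nat) (e : rel 'I_N) (g h : R -> R)
    (K : R) (a : nat -> R) (y r : nat -> 'I_N -> R) :
  symmetric e -> connected_graph e ->
  (forall x, g (- x) = - g x) -> {homo g : x y / x <= y} ->
  (forall x, 0 < x -> 0 < g x) -> (forall x, `|g x| <= K) ->
  {homo h : x y / x < y} ->
  (forall t, 0 < a t) -> (\sum_(0 <= t <oo) (a t)%:E = +oo)%E -> a @ \oo --> 0 ->
  (forall i, r^~ i @ \oo --> 0) -> \sum_i y 0%N i = 0 ->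
  (forall t i, y t.+1 i = y t i - a t *
     \sum_(j | e i j) g (h (y t i - r t i) - h (y t j - r t j))) ->
  forall i, y^~ i @ \oo --> 0.
Proof.
move=> e_sym e_conn g_odd g_mono g_pos gK h_incr a0 adiv acvg rcvg y0 ystep.
have g0 : g 0 = 0 by have := g_odd 0; rewrite oppr0; lra.
have K0 : 0 <= K by exact: le_trans (gK 0).
pose w t i j := g (h (y t i - r t i) - h (y t j - r t j)).
have w_anti t i j : w t j i = - w t i j by rewrite /w -g_odd opprB.
have ybal t : \sum_i y t i = 0.
  elim: t => // t IH; rewrite (eq_bigr _ (fun i _ => ystep t i)) sumrB IH.
  by rewrite -mulr_sumr (sum_flow_eq0 e_sym (w_anti t)) mulr0 subr0.
have rsmall k : 0 < k -> \forall t \near \oo, forall i, `|r t i| <= k.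
  move=> k0; apply: filter_forall => i.
  by have /cvgr0Pnorm_le/(_ k k0) := rcvg i.
pose V t := \sum_i y t i ^+ 2.
pose D t := \sum_i \sum_(j | e i j) (y t i - y t j) * w t i j.
(* Bounds the quadratic term of [energy_step]: each node has at most [N] neighbours, each
   contributing at most [K]. *)
pose B := \sum_(i < N) (N%:R * K) ^+ 2.
have B0 : 0 <= B by apply: sumr_ge0 => i _; exact: sqr_ge0.
have Vstep t : V t.+1 <= V t - a t * (D t - a t * B).
  have -> : V t.+1 = V t - a t * D t + a t ^+ 2 * \sum_i (\sum_(j | e i j) w t i j) ^+ 2.
    rewrite -(energy_step (y t) (a t) e_sym (w_anti t)).
    by apply: eq_bigr => i _; rewrite ystep.
  have : \sum_i (\sum_(j | e i j) w t i j) ^+ 2 <= B.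
    apply: ler_sum => i _; rewrite -real_normK ?num_real// lerXn2r ?nnegrE//.
      by rewrite mulr_ge0.
    apply: le_trans (ler_norm_sum _ _ _) _.
    apply: (@le_trans _ _ (\sum_(j < N) K)).
      rewrite big_mkcond/=; apply: ler_sum => j _; case: ifP => // _; exact: gK.
    by rewrite sumr_const card_ord mulr_natl.
  move=> /(ler_wpM2l (sqr_ge0 (a t))); rewrite expr2; lra.
pose M := N%:R * N%:R * (2 * K).
have M0 : 0 <= M by rewrite !mulr_ge0.
have Dge t k : 0 <= k -> (forall i, `|r t i| <= k) -> - (k * M) <= D t /\
    forall u v c, e u v -> c <= (y t u - y t v) * w t u v -> c - k * M <= D t.
  move=> k0 rk.
  have -> : k * M = N%:R * N%:R * (2 * k * K) by rewrite /M; ring.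
  apply: edge_sum_ge => [|i j]; first by rewrite !mulr_ge0.
  exact: (edge_term_ge _ _ g_mono g0 gK h_incr (rk i) (rk j)).
have small b : 0 < b -> \forall t \near \oo, a t * B <= b.
  move=> b0; have : (fun t => a t * B) @ \oo --> 0 * B by apply: cvgMl.
  rewrite mul0r => /cvgr0Pnorm_le/(_ b b0); apply: filterS => t.
  by rewrite ger0_norm// mulr_ge0// ltW.
have Vcvg : V @ \oo --> 0.
  apply: (@perturbed_descent_cvg0 R V a) => //.
  - by move=> t; apply: sumr_ge0 => i _; exact: sqr_ge0.
  (* Half of [b] pays for the perturbation, half for the quadratic term; [M + 1] avoids division by
     zero. *)
  - move=> b b0; pose k := b / 2 / (M + 1).
    have k0 : 0 < k by rewrite !divr_gt0//; lra.
    have kM : k * M <= b / 2.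
      by rewrite /k -mulrA ler_piMr ?divr_ge0 ?ltW// mulrC ltr_pdivrMr; lra.
    have := small (b / 2) ltac:(lra); have := rsmall _ k0.
    apply: filterS2 => t rk aB; apply: le_trans (Vstep t) _.
    rewrite -mulrN lerD2l ler_pM2l//.
    by have [D1 _] := Dge t k (ltW k0) rk; lra.
  - move=> b b0.
    have N0 : 0 < N%:R :> R by rewrite ltr0n; case: e_conn.
    (* If all [y t i] were below [dl] in absolute value, the energy would be below
       [N * dl ^+ 2 = b]. *)
    pose dl := Num.sqrt (b / N%:R).
    have dl0 : 0 < dl by rewrite sqrtr_gt0 divr_gt0.
    have [c c0 [k1 k10 Hc]] := consensus_gain e_conn g_mono g_pos h_incr dl0.
    (* Of the gain [c], at most a quarter is lost to [r] and a quarter to the quadratic term. *)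
    exists (c / 2); first lra.
    pose k := Num.min k1 (c / 4 / (M + 1)).
    have k0 : 0 < k by rewrite lt_min k10 !divr_gt0//; lra.
    have kM : k * M <= c / 4.
      apply: (@le_trans _ _ (c / 4 / (M + 1) * M)).
        by rewrite ler_wpM2r// ge_min lexx orbT.
      by rewrite -mulrA ler_piMr ?divr_ge0 ?ltW// mulrC ltr_pdivrMr; lra.
    have := small (c / 4) ltac:(lra); have := rsmall _ k0.
    apply: filterS2 => t rk aB bV; apply: le_trans (Vstep t) _.
    rewrite lerD2l lerN2 ler_pM2l//.
    have [_ D2] := Dge t k (ltW k0) rk.
    have [||u [v [euv cuv]]] := Hc (y t) (r t) (ybal t).
    + apply: contrapT => /forallNP nP.
      have : V t < b; last by rewrite ltNge bV.
      rewrite (_ : b = \sum_(i < N) b / N%:R); last first.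
        by rewrite sumr_const card_ord -[RHS]mulr_natl mulrC divfK ?gt_eqF.
      have [i0 _] : exists i : 'I_N, true.
        by case: e_conn => N00 _; exists (Ordinal N00).
      apply: ltr_sum => [|i _]; first by apply/hasP; exists i0 => //; rewrite mem_index_enum.
      have /negP := nP i; rewrite -ltNge => yi.
      rewrite -[ltRHS]sqr_sqrtr; last by rewrite divr_ge0// ltW.
      by rewrite -real_normK ?num_real// ltrXn2r// nnegrE ltW.
    + by move=> i; apply: le_trans (rk i) _; rewrite ge_min lexx.
    have := D2 u v c euv cuv; lra.
move=> i; apply/cvgr0Pnorm_le => b b0.
have /cvgr0Pnorm_le/(_ (b ^+ 2) (exprn_gt0 2 b0)) := Vcvg.
apply: filterS => t; rewrite ger0_norm; last by apply: sumr_ge0 => j _; exact: sqr_ge0.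
rewrite /V (bigD1 i)//= => Vb.
have : `|y t i| ^+ 2 <= b ^+ 2.
  rewrite real_normK ?num_real//; apply: le_trans Vb; rewrite lerDl.
  by apply: sumr_ge0 => j _; exact: sqr_ge0.
by rewrite ler_pXn2r// nnegrE ltW.
Qed.

Lemma consensus (R : realType) (N : nat) (e : rel 'I_N) (g h : R -> R)
    (K : R) (a : nat -> R) (x v : nat -> 'I_N -> R) :
  symmetric e -> connected_graph e ->
  (forall x, g (- x) = - g x) -> {homo g : x y / x <= y} ->
  (forall x, 0 < x -> 0 < g x) -> (forall x, `|g x| <= K) ->
  {homo h : x y / x < y} ->
  (forall t, 0 < a t) -> (\sum_(0 <= t <oo) (a t)%:E = +oo)%E -> a @ \oo --> 0 ->
  (forall i, cvgn (series (v^~ i))) ->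
  (forall t i, x t.+1 i = x t i - a t *
     \sum_(j | e i j) g (h (x t i) - h (x t j)) + v t i) ->
  exists l : R, forall i, x^~ i @ \oo --> l.
Proof.
move=> e_sym e_conn g_odd g_mono g_pos gK h_incr a0 adiv acvg vcvg xstep.
have N0 : 0 < N%:R :> R by rewrite ltr0n; case: e_conn.
pose r t i := limn (series (v^~ i)) - series (v^~ i) t.
(* [r 0] is the full sum of the noise series, so [m] is the mean of the initial state plus the total
   noise. It is the limit, and subtracting it balances [y]. *)
pose m := (\sum_i (x 0%N i + r 0%N i)) / N%:R.
pose y t i := x t i + r t i - m.
have rcvg i : r^~ i @ \oo --> 0.
  rewrite -(subrr (limn (series (v^~ i)))).
  by apply: cvgB; [exact: cvg_cst|exact: vcvg].
have ycvg : forall i, y^~ i @ \oo --> 0.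
  (* Since [r] drops by [v t] at each step, [x + r] no longer sees the noise; shifting [h] by [m]
     undoes the centering. *)
  apply: (@balanced_consensus R N e g (fun z => h (z + m)) K a y r) => //.
  - by move=> p q pq; apply: h_incr; rewrite ltrD2r.
  - rewrite /y sumrB sumr_const card_ord -[m *+ _]mulr_natl mulrC divfK ?gt_eqF//.
    by rewrite subrr.
  - move=> t i; have yE j : y t j - r t j + m = x t j by rewrite /y; ring.
    under eq_bigr => j _ do rewrite !yE.
    by rewrite /y xstep /r seriesSr; ring.
exists m => i.
have : (fun t => y t i - r t i + m) @ \oo --> 0 - 0 + m.
  by apply: cvgD; [exact: cvgB|exact: cvg_cst].
rewrite subr0 add0r (_ : (fun t => _) = x^~ i)//.
by apply/funext => t; rewrite /y; ring.
Qed.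

(** * Bounded integrands and independence *)

Section BoundedIntegrals.
Context {d : measure_display} {T : measurableType d} {R : realType}.
Variable P : probability T R.

Lemma bounded_fun_integrable (u : T -> R) (K : R) :
  measurable_fun setT u -> (forall w, `|u w| <= K) ->
  P.-integrable setT (EFin \o u).
Proof.
move=> mu uK; apply: measurable_bounded_integrable => //.
  exact: le_lt_trans (probability_le1 P measurableT) (ltry 1).
exists K; split; first exact: num_real.
by move=> M KM w _ /=; exact: le_trans (uK w) (ltW KM).
Qed.

Lemma Rintegral_bounded (u : T -> R) (K : R) :
  measurable_fun setT u -> (forall w, `|u w| <= K) ->
  `|\int[P]_w u w| <= K.
Proof.
move=> mu uK.
have iu := bounded_fun_integrable mu uK.
have iK : P.-integrable setT (EFin \o (fun=> K)).
  by apply: (@bounded_fun_integrable _ `|K|) => //.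
have -> : K = \int[P]_w K.
  rewrite Rintegral_cst// -[LHS]mulr1; congr (_ * _).
  exact: (congr1 fine (esym (probability_setT P))).
apply: le_trans (le_normr_Rintegral _ iu) _ => //.
apply: le_Rintegral => //.
by apply: (@bounded_fun_integrable _ K) => [|w]; rewrite ?normr_id//; exact: measurableT_comp.
Qed.

(** A zero integral would make [u] vanish almost everywhere, and the whole space would be null. *)
Lemma Rintegral_gt0 (u : T -> R) (K : R) :
  measurable_fun setT u -> (forall w, `|u w| <= K) -> (forall w, 0 < u w) ->
  0 < \int[P]_w u w.
Proof.
move=> mu uK u0.
have iu := bounded_fun_integrable mu uK.
have := @Rintegral_ge0 _ _ _ P setT u (fun w _ => ltW (u0 w)).
rewrite le_eqVlt => /predU1P[iu0|//].
have : (\int[P]_w `|(EFin \o u) w| = 0)%E.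
  under eq_integral do rewrite /= gtr0_norm//.
  by rewrite -[LHS]fineK ?(integrable_fin_num _ iu)//; exact: (congr1 EFin (esym iu0)).
have mEu : measurable_fun setT (EFin \o u) by exact/measurable_EFinP.
move/(ae_eq_integral_abs P measurableT mEu) => [A [mA A0 uA]].
have AT : A = setT.
  apply/seteqP; split => // w _; apply: uA => /= /(_ Logic.I) /eqP.
  by rewrite eqe gt_eqF.
have := probability_setT P; rewrite -AT A0 => /eqP; rewrite eqe eq_sym.
by rewrite oner_eq0.
Qed.

(** Independence makes the law of the pair a product; Fubini then integrates over [n] with [Z]
    frozen. *)
Lemma indep_Rintegral_eq0 d' (T' : measurableType d') (Z : {mfun T >-> T'})
    (n : {RV P >-> R}) (F : T' * R -> R) (K : R) :
  (forall A B, measurable A -> measurable B ->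
    P (Z @^-1` A `&` n @^-1` B) = (P (Z @^-1` A) * P (n @^-1` B))%E) ->
  measurable_fun setT F -> (forall p, `|F p| <= K) ->
  (forall z, \int[P]_w F (z, n w) = 0) ->
  \int[P]_w F (Z w, n w) = 0.
Proof.
move=> ind mF FK F0.
have mZn : measurable_fun setT (fun w => (Z w, n w)) by exact: measurable_fun_pair.
pose J := distribution P (mfun_Sub (mem_set mZn)).
have JE X : measurable X -> (distribution P Z \x distribution P n)%E X = J X.
  apply: product_measure_unique => A B mA mB.
  by rewrite -[RHS]ind.
have mEF : measurable_fun setT (EFin \o F) by exact/measurable_EFinP.
have iJ : (distribution P Z \x distribution P n)%E.-integrable setT (EFin \o F).
  apply: measurable_bounded_integrable => //.
    apply: le_lt_trans (le_lt_trans (probability_le1 J measurableT) (ltry 1)).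
    by rewrite le_eqVlt; apply/orP; left; apply/eqP; exact: JE.
  exists K; split; first exact: num_real.
  by move=> M KM w _ /=; exact: le_trans (FK w) (ltW KM).
rewrite /Rintegral; apply/eqP; rewrite -eqe; apply/eqP.
have iP : P.-integrable setT (EFin \o (fun w => F (Z w, n w))).
  by apply: (@bounded_fun_integrable _ K) => //; exact: measurableT_comp mF mZn.
rewrite fineK ?(integrable_fin_num _ iP)//.
transitivity (\int[J]_p (EFin \o F) p)%E.
  by rewrite integral_distribution.
transitivity (\int[distribution P Z \x distribution P n]_p (EFin \o F) p)%E.
  by apply: eq_measure_integral => A mA _; exact/esym/JE.
rewrite -integral12_prod_meas1//.
apply: integral0_eq => z _; rewrite /fubini_F.
have mFz : measurable_fun setT (fun u => F (z, u)).
  exact: measurableT_comp mF (measurable_pair1 z).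
have iz : P.-integrable setT (EFin \o (fun w => F (z, n w))).
  by apply: (@bounded_fun_integrable _ K) => //; exact: (measurableT_comp mFz).
transitivity (\int[P]_w (F (z, n w))%:E)%E.
  by rewrite integral_distribution//; exact/measurable_EFinP.
by rewrite -[LHS]fineK ?(integrable_fin_num _ iz)//; congr EFin; exact: F0.
Qed.
End BoundedIntegrals.

(** * Convergence of weighted martingale differences *)

Section GeneratedAlgebra.
Context {d : measure_display} {T : measurableType d} {R : realType}.

Lemma sub_sigma_measurable (C : set (set T)) :
  C `<=` measurable -> <<s C >> `<=` measurable.
Proof.
move=> CT; apply: smallest_sub => //; split=> //.
- by move=> A mA; rewrite setTD; exact: measurableC.
- by move=> F mF; exact: bigcupT_measurable.
Qed.

(** Filtrations are given by generating families; putting the generated sigma-algebra on the domain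
    turns adaptedness into plain measurability. *)
Definition adapted (C : set (set T)) (u : T -> R) :=
  measurable_fun (setT : set (g_sigma_algebraType C)) (u : g_sigma_algebraType C -> R).

Lemma adapted_mono (C C' : set (set T)) (u : T -> R) :
  C `<=` C' -> adapted C u -> adapted C' u.
Proof.
move=> CC' mu _ Y mY; have := mu measurableT Y mY.
exact: sub_smallest2r.
Qed.

Lemma adapted_measurable (C : set (set T)) (u : T -> R) :
  C `<=` measurable -> adapted C u -> measurable_fun setT u.
Proof.
by move=> CT mu _ Y mY; exact: sub_sigma_measurable (mu measurableT Y mY).
Qed.

End GeneratedAlgebra.

Section MartingaleDifferences.
Context {d : measure_display} {T : measurableType d} {R : realType}.
Variables (P : probability T R) (C : nat -> set (set T)).
Hypothesis C_measurable : forall t, C t `<=` measurable.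
Hypothesis C_mono : forall t, C t `<=` C t.+1.
Variables (xi : nat -> T -> R) (a : nat -> R) (K : R).
Hypothesis xi_adapted : forall t, adapted (C t.+1) (xi t).
Hypothesis xi_bounded : forall t w, `|xi t w| <= K.
(** The martingale difference property, tested against bounded adapted functions instead of being
    stated by conditional expectation. *)
Hypothesis xi_orth : forall t u M, adapted (C t) u -> (forall w, `|u w| <= M) ->
  \int[P]_w (u w * xi t w) = 0.

Let S w n := series (fun t => a t * xi t w) n.

(* Freezing the sum once it leaves the [eps]-ball replaces a maximal inequality:
   all frozen sums have orthogonal increments, so Chebyshev's inequality at the
   last index controls the whole excursion. *)
Fixpoint stopped (m : nat) (eps : R) (k : nat) (w : T) : R :=
  if k is k'.+1 then
    let u := stopped m eps k' w in
    u + (if `|u| < eps then a (m + k')%N * xi (m + k')%N w else 0)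
  else 0.

Lemma stopped_adapted m eps k : adapted (C (m + k)%N) (stopped m eps k).
Proof.
elim: k => [|k IH]; first exact: measurable_cst.
have IH' : adapted (C (m + k).+1) (stopped m eps k) by exact: adapted_mono IH.
rewrite addnS; apply: measurable_funD => //.
apply: measurable_fun_ifT => //.
  by apply: measurable_fun_ltr => //; exact: measurableT_comp.
by apply: measurable_funM => //; exact: xi_adapted.
Qed.

Lemma stopped_measurable m eps k : measurable_fun setT (stopped m eps k).
Proof. exact: adapted_measurable (@C_measurable _) (@stopped_adapted m eps k). Qed.

(** A crude bound, serving only integrability and the boundedness asked by [xi_orth]. *)
Lemma stopped_bounded m eps k w :
  `|stopped m eps k w| <= \sum_(j < k) `|a (m + j)%N| * K.
Proof.
elim: k => [|k IH] /=; first by rewrite normr0 big_ord0.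
rewrite big_ord_recr/=; apply: le_trans (ler_normD _ _) _; apply: lerD => //.
case: ifP => _; first by rewrite normrM ler_wpM2l.
by rewrite normr0 mulr_ge0//; exact: le_trans (xi_bounded 0 w).
Qed.

Lemma stopped_sqr_le m eps k :
  \int[P]_w (stopped m eps k w ^+ 2) <= K ^+ 2 * \sum_(j < k) a (m + j)%N ^+ 2.
Proof.
elim: k => [|k IH] /=.
  rewrite big_ord0 mulr0 (_ : (fun=> _) = cst 0) ?Rintegral_cst// ?mul0r//.
  by apply/funext => w; rewrite expr0n.
pose u := stopped m eps k.
pose M := \sum_(j < k) `|a (m + j)%N| * K.
pose b := a (m + k)%N.
(* Squaring one step leaves the cross term [v * xi], which integrates to 0 because [v] is adapted,
   and the squared increment [q]. *)
pose v w := if `|u w| < eps then 2 * b * u w else 0.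
pose q w := (if `|u w| < eps then b * xi (m + k)%N w else 0) ^+ 2.
have uM w : `|u w| <= M by exact: stopped_bounded.
have M0 w : 0 <= M := le_trans (normr_ge0 _) (uM w).
have mu := @stopped_measurable m eps k.
have mc : measurable_fun [set: T] (fun w => `|u w| < eps).
  by apply: measurable_fun_ltr => //; exact: measurableT_comp.
have mxi t : measurable_fun [set: T] (xi t).
  exact: adapted_measurable (@C_measurable _) (@xi_adapted t).
have av : adapted (C (m + k)%N) v.
  have au := @stopped_adapted m eps k.
  apply: measurable_fun_ifT => //.
    by apply: measurable_fun_ltr => //; exact: measurableT_comp.
  exact: measurable_funM.
have vM w : `|v w| <= `|2 * b| * M.
  rewrite /v; case: ifP => _; first by rewrite normrM ler_wpM2l.
  by rewrite normr0 mulr_ge0// (M0 w).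
have K0 w : 0 <= K := le_trans (normr_ge0 _) (xi_bounded 0 w).
have qK w : `|q w| <= b ^+ 2 * K ^+ 2.
  rewrite /q; case: ifP => _; last by rewrite expr0n normr0 mulr_ge0 ?sqr_ge0.
  rewrite normrX normrM exprMn real_normK ?num_real// ler_wpM2l ?sqr_ge0//.
  by rewrite lerXn2r ?nnegrE// (K0 w).
have mq : measurable_fun setT q.
  by apply: measurable_funX; apply: measurable_fun_ifT => //; exact: measurable_funM.
have iq : P.-integrable setT (EFin \o q) by exact: bounded_fun_integrable qK.
have iu : P.-integrable setT (EFin \o (fun w => u w ^+ 2)).
  apply: (@bounded_fun_integrable _ _ _ _ _ (M ^+ 2)) => [|w]; first exact: measurable_funX.
  by rewrite normrX lerXn2r ?nnegrE// (M0 w).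
have mv : measurable_fun setT v := adapted_measurable (@C_measurable _) av.
have ivx : P.-integrable setT (EFin \o (fun w => v w * xi (m + k)%N w)).
  apply: (@bounded_fun_integrable _ _ _ _ _ (`|2 * b| * M * K)) => [|w].
    exact: measurable_funM.
  by rewrite normrM ler_pM.
have iuv : P.-integrable setT (EFin \o (fun w => u w ^+ 2 + v w * xi (m + k)%N w)).
  exact: integrableD iu ivx.
rewrite (_ : (fun w => _) = (fun w => (u w ^+ 2 + v w * xi (m + k)%N w) + q w)); last first.
  by apply/funext => w; rewrite /v /q -/u; case: ifP => _; rewrite /b; ring.
rewrite RintegralD// RintegralD// (xi_orth av vM) addr0 big_ord_recr/= mulrDr lerD//.
apply: le_trans (ler_norm _) _.
by rewrite mulrC; exact: Rintegral_bounded.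
Qed.

(** Freezing happens only outside the ball and is permanent, so a value inside shows that the sum
    was never frozen. *)
Lemma stopped_lt m eps k w : `|stopped m eps k w| < eps ->
  stopped m eps k w = S w (m + k)%N - S w m /\
  forall j, (j <= k)%N -> `|S w (m + j)%N - S w m| < eps.
Proof.
elim: k => [|k IH] /=.
  rewrite addn0 subrr => eps0; split=> // j; rewrite leqn0 => /eqP ->.
  by rewrite addn0 subrr.
case: ifPn => [uk uk1|/negbTE nuk]; last by rewrite addr0 nuk.
have [uE uS] := IH uk.
have uE1 : stopped m eps k w + a (m + k)%N * xi (m + k)%N w =
    S w (m + k.+1)%N - S w m.
  by rewrite uE addnS /S seriesSr; ring.
split=> // j; rewrite leq_eqVlt => /predU1P[->|]; last by rewrite ltnS; exact: uS.
by rewrite -uE1.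
Qed.

Lemma stopped_markov (m : nat) (eps : R) (k : nat) : 0 < eps ->
  (P [set w | (eps <= `|stopped m eps k w|)%R]
    <= ((K / eps) ^+ 2 * \sum_(j < k) a (m + j)%N ^+ 2)%:E)%E.
Proof.
move=> eps0.
have mu := @stopped_measurable m eps k.
set A := [set w | _].
have mA : measurable A.
  rewrite -[A]setTI; apply: measurable_fun_ler => //; exact: measurableT_comp.
have iu : P.-integrable setT (EFin \o (fun w => stopped m eps k w ^+ 2)).
  apply: (@bounded_fun_integrable _ _ _ _ _ ((\sum_(j < k) `|a (m + j)%N| * K) ^+ 2)).
    exact: measurable_funX.
  move=> w; rewrite normrX lerXn2r ?nnegrE// ?stopped_bounded//.
  exact: le_trans (stopped_bounded m eps k w).
have : (\int[P]_w ((eps ^+ 2)%:E * (\1_A w)%:E) <= \int[P]_w (stopped m eps k w ^+ 2)%:E)%E.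
  apply: ge0_le_integral => //=.
  - by move=> w _; rewrite mule_ge0// lee_fin// sqr_ge0.
  - by apply: emeasurable_funM => //; exact/measurable_EFinP/measurable_indic.
  - by exact/measurable_EFinP/measurable_funX.
  - move=> w _; rewrite indicE -EFinM lee_fin; case: (boolP (w \in A)) => [|_] /=.
      rewrite inE /A /= mulr1 => epsu; rewrite -[leRHS]real_normK ?num_real//.
      by rewrite lerXn2r// nnegrE ltW.
    by rewrite mulr0 sqr_ge0.
have mI : measurable_fun setT (fun w : T => (\1_A w : R)%:E).
  exact/measurable_EFinP/measurable_indic.
rewrite (ge0_integralZl P measurableT mI)//; last by rewrite lee_fin sqr_ge0.
rewrite integral_indic// setIT.
have -> : (\int[P]_w (stopped m eps k w ^+ 2)%:E)%E =
    (\int[P]_w (stopped m eps k w ^+ 2))%:E.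
  by rewrite /Rintegral fineK// (integrable_fin_num _ iu).
move=> H.
have {H} : ((eps ^+ 2)%:E * P A <= (K ^+ 2 * \sum_(j < k) a (m + j)%N ^+ 2)%:E)%E.
  by apply: le_trans H _; rewrite lee_fin; exact: stopped_sqr_le.
by move=> H; rewrite exprMn exprVn mulrAC EFinM lee_pdivlMr ?exprn_gt0// muleC.
Qed.

Lemma measurable_stopped_ge (m : nat) (eps : R) (k : nat) :
  measurable [set w | eps <= `|stopped m eps k w|].
Proof.
rewrite -[X in measurable X]setTI; apply: measurable_fun_ler => //.
exact/measurableT_comp/(@stopped_measurable m eps k).
Qed.

(** A frozen sum stays outside, so the events increase and continuity from below applies to their
    union. *)
Lemma stopped_ge_mono (m : nat) (eps : R) :
  {homo (fun k => [set w | eps <= `|stopped m eps k w|]) : p q / (p <= q)%N >-> (p <= q)%O}.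
Proof.
apply: homo_leq => [A|A B D|k]; [exact: lexx|exact: le_trans|].
apply/subsetPset => w /= ge.
by rewrite ltNge ge /= addr0.
Qed.

Lemma mds_cvg : (\sum_(0 <= t <oo) (a t ^+ 2)%:E < +oo)%E ->
  \forall w \ae P, cvgn (S w).
Proof.
move=> a2.
have a20 t : 0 <= a t ^+ 2 by exact: sqr_ge0.
have a2cvg := nnseries_is_cvg a20 a2.
have tail b : 0 < b -> exists m, forall k, \sum_(j < k) a (m + j)%N ^+ 2 <= b.
  move=> b0; have /cvgrPdist_le/(_ b b0)[m _ /(_ m (leqnn m))] := a2cvg.
  move=> /= /(le_trans (ler_norm _)) bm; exists m => k.
  have -> : \sum_(j < k) a (m + j)%N ^+ 2 =
      series (fun t => a t ^+ 2) (m + k)%N - series (fun t => a t ^+ 2) m.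
    rewrite sub_series_geq ?leq_addr// -{2}[m]add0n big_addn addKn big_mkord.
    by apply: eq_bigr => j _; rewrite addnC.
  apply: le_trans bm; apply: lerB => //.
  by apply: nondecreasing_cvgn_le => //; apply: nondecreasing_series => *; exact: a20.
(* The event that the partial sums, restarted at [m], ever move by [eps] or more. *)
pose bad m eps := \bigcup_k [set w | eps <= `|stopped m eps k w|].
have mbad m eps : measurable (bad m eps).
  by apply: bigcupT_measurable => k; exact: measurable_stopped_ge.
have Pbad m eps b : 0 < eps -> (forall k, \sum_(j < k) a (m + j)%N ^+ 2 <= b) ->
    (P (bad m eps) <= ((K / eps) ^+ 2 * b)%:E)%E.
  move=> eps0 ab.
  have cP := nondecreasing_cvg_mu (mu := P) (measurable_stopped_ge m eps)
    (mbad m eps) (stopped_ge_mono m eps).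
  rewrite -(cvg_lim (@ereal_hausdorff R) cP).
  apply: lime_le; first by apply/cvg_ex; eexists; exact: cP.
  apply: nearW => k; apply: le_trans (stopped_markov m k eps0) _.
  by rewrite lee_fin ler_wpM2l ?sqr_ge0.
have null eps : 0 < eps -> P (\bigcap_m bad m eps) = 0%E.
  move=> eps0; apply/eqP; rewrite eq_le measure_ge0 andbT.
  apply/lee_addgt0Pr => b b0; rewrite add0e.
  (* A tail of squares below [c] makes the bad event at most [b] likely; the [+ 1] covers
     [K = 0]. *)
  pose c := b / ((K / eps) ^+ 2 + 1).
  have Ke : 0 <= (K / eps) ^+ 2 by exact: sqr_ge0.
  have c0 : 0 < c by rewrite divr_gt0//; lra.
  have [m Hm] := tail c c0.
  apply: (@le_trans _ _ (P (bad m eps))).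
    apply: le_measure; rewrite ?inE//; first exact: bigcapT_measurable.
    exact: bigcap_inf.
  apply: le_trans (Pbad m eps c eps0 Hm) _; rewrite lee_fin.
  by rewrite /c mulrCA; apply: ler_piMr; [exact: ltW|rewrite ler_pdivrMr; lra].
have : \forall w \ae P, forall p : nat, ~ (\bigcap_m bad m p.+1%:R^-1) w.
  apply: ae_foralln => p; exists (\bigcap_m bad m p.+1%:R^-1); split.
  - exact: bigcapT_measurable.
  - by apply: null; rewrite invr_gt0.
  - by move=> w /= /contrapT.
(* Off countably many null sets, for each [p] some restart never leaves the ball of radius
   [p.+1%:R^-1], so the sums are Cauchy. *)
apply: filterS => w good; apply/cauchy_cvgP/cauchy_exP => eps eps0.
have [p peps] : exists p : nat, p.+1%:R^-1 < eps.
  exists (Num.bound eps^-1); rewrite invf_plt ?posrE//.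
  by rewrite (lt_trans (archi_boundP _))// ?invr_ge0 ?ltW// ltr_nat.
have /existsNP[m nbad] := good p.
have stay k : `|stopped m p.+1%:R^-1 k w| < p.+1%:R^-1.
  by rewrite ltNge; apply/negP => ge; apply: nbad => _; exists k.
exists (S w m); exists m => // t /= mt.
have [_ /(_ _ (leqnn _))] := stopped_lt (stay (t - m)%N).
by rewrite subnKC// /ball/= distrC => /lt_trans; apply.
Qed.

End MartingaleDifferences.

(** * Orthogonality of the noise to the past *)

Section Independence.
Context {d : measure_display} {T : measurableType d} {R : realType}.
Variable P : probability T R.

(** Both sides are finite measures in [B]; they agree on a pi-system containing the whole space,
    hence on the sigma-algebra it generates. *)
Lemma sigma_indep (C : set (set T)) (E : set T) :
  C `<=` measurable -> setI_closed C -> C setT -> measurable E ->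
  (forall B, C B -> P (B `&` E) = (P B * P E)%E) ->
  forall B, <<s C >> B -> P (B `&` E) = (P B * P E)%E.
Proof.
move=> CT CI C1 mE ind B sB.
pose r := NngNum (fine_ge0 (measure_ge0 P E)).
have rE : (fine (P E))%:E = P E by rewrite fineK// fin_num_measure.
have ms X : (P X * P E)%E = mscale r P X by rewrite /mscale/= rE muleC.
rewrite ms.
change (mrestr P mE B = mscale r P B).
apply: (@g_sigma_algebra_measure_unique _ R T C CT (fun=> setT)) sB => //.
- by apply/seteqP; split=> // w _; exists 0%N.
- by move=> A CA; transitivity (P A * P E)%E; [exact: ind|exact: ms].
- move=> _; apply: le_lt_trans (ltry 1); apply: probability_le1.
  exact: measurableI.
Qed.

Lemma indep_orth (C : set (set T)) (n : {RV P >-> R}) (f g : R -> R) (u D : T -> R)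
    (K M : R) :
  C `<=` measurable ->
  (forall A B, <<s C >> A -> measurable B ->
    P (A `&` n @^-1` B) = (P A * P (n @^-1` B))%E) ->
  measurable_fun setT f -> (forall x, `|f x| <= K) ->
  measurable_fun setT g -> (forall c, g c = \int[P]_w f (c - n w)) ->
  adapted C u -> (forall w, `|u w| <= M) -> adapted C D ->
  \int[P]_w (u w * (f (D w - n w) - g (D w))) = 0.
Proof.
move=> CT ind mf fK mg gE au uM aD.
(* The identity into [T] with the coarser sigma-algebra acts as the whole past, a single random
   element independent of [n]. *)
have midT : measurable_fun setT (id : T -> g_sigma_algebraType C).
  by move=> _ Y mY; rewrite setTI; exact: sub_sigma_measurable mY.
pose F (p : g_sigma_algebraType C * R) := u p.1 * (f (D p.1 - p.2) - g (D p.1)).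
have mfn c : measurable_fun setT (fun w => f (c - n w)).
  by apply: (measurableT_comp mf); exact: measurable_funB.
have gK c : `|g c| <= K by rewrite gE; exact: Rintegral_bounded.
apply: (@indep_Rintegral_eq0 _ _ _ P _ _ (mfun_Sub (mem_set midT)) n F (M * (K + K))).
- by move=> A B mA mB; exact: ind.
- have mD : measurable_fun setT (fun p : g_sigma_algebraType C * R => D p.1).
    exact: measurableT_comp aD measurable_fst.
  apply: measurable_funM; first exact: measurableT_comp au measurable_fst.
  apply: measurable_funB; last exact: measurableT_comp mg mD.
  by apply: (measurableT_comp mf); apply: measurable_funB => //; exact: measurable_snd.
- move=> p; rewrite /F normrM ler_pM//.
  by apply: le_trans (ler_normB _ _) _; exact: lerD.
move=> z; rewrite /F/=.
have iz : P.-integrable setT (EFin \o (fun w => f (D z - n w))).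
  exact: bounded_fun_integrable (mfn _) (fun w => fK _).
have ic : P.-integrable setT (EFin \o (fun=> g (D z))).
  exact: (@bounded_fun_integrable _ _ _ _ _ K).
rewrite RintegralZl//; last exact: (integrableB measurableT iz ic).
rewrite RintegralB// -gE Rintegral_cst//.
apply/eqP; rewrite mulf_eq0 subr_eq0; apply/orP; right; rewrite -[X in X == _]mulr1.
apply/eqP; congr (_ * _); exact: (congr1 fine (esym (probability_setT P))).
Qed.

Section Cylinders.
Variables (I : choiceType) (X : I -> {RV P >-> R}).

(** A pi-system generating the sigma-algebra of the variables indexed by [J], on which mutual
    independence can be read off. *)
Definition cylinders (J : {fset I}) : set (set T) :=
  [set B | exists2 A : I -> set R, (forall k, measurable (A k)) &
    B = \bigcap_(k in [set` J]) X k @^-1` A k].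

Lemma cylinders_measurable (J : {fset I}) : cylinders J `<=` measurable.
Proof.
move=> _ [A mA ->]; apply: fin_bigcap_measurable => // k _.
by rewrite -[_ @^-1` _]setTI; exact: measurable_funP.
Qed.

Lemma cylinders_setI (J : {fset I}) : setI_closed (cylinders J).
Proof.
move=> _ _ [A mA ->] [B mB ->]; exists (fun k => A k `&` B k).
  by move=> k; exact: measurableI.
by rewrite -bigcapI.
Qed.

Lemma cylinders_setT (J : {fset I}) : cylinders J setT.
Proof. by exists (fun=> setT) => //; rewrite bigcapT. Qed.

Lemma cylinders_mono (J J' : {fset I}) :
  (forall k, k \in J -> k \in J') -> cylinders J `<=` cylinders J'.
Proof.
move=> JJ' _ [A mA ->]; exists (fun k => if k \in J then A k else setT).
  by move=> k; case: ifP.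
apply/seteqP; split=> w Aw k /= kJ.
  by case: ifP => // kJ0; exact: Aw.
by have := Aw k (JJ' k kJ); rewrite kJ.
Qed.

Lemma cylinders_adapted (J : {fset I}) (k : I) :
  k \in J -> adapted (cylinders J) (X k).
Proof.
move=> kJ _ Y mY; rewrite setTI; apply: sub_sigma_algebra.
exists (fun i => if i == k then Y else setT); first by move=> i; case: ifP.
apply/seteqP; split=> [w Yw i _ /=|w /(_ k kJ)]; last by rewrite /= eqxx.
by case: eqP => // ->.
Qed.

(** On a cylinder, the product formulas over [J] and over [J] enlarged by [k] are compared;
    [sigma_indep] extends the result. *)
Lemma cylinders_indep (D : set I) (J : {fset I}) (k : I) (B : set R) (A : set T) :
  mutually_independent D X -> [set` J] `<=` D -> D k -> k \notin J ->
  measurable B -> <<s cylinders J >> A ->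
  P (A `&` X k @^-1` B) = (P A * P (X k @^-1` B))%E.
Proof.
move=> ind JD Dk kJ mB.
have mXB : measurable (X k @^-1` B).
  by rewrite -[_ @^-1` _]setTI; exact: measurable_funP.
apply: sigma_indep => //.
- exact: cylinders_measurable.
- exact: cylinders_setI.
- exact: cylinders_setT.
move=> _ [F mF ->]; rewrite (ind J)//.
pose F' i := if i == k then B else F i.
have F'k : F' k = B by rewrite /F' eqxx.
have kD : [set` (k |` J)%fset] `<=` D.
  by move=> i /=; rewrite in_fset1U => /predU1P[->//|]; exact: JD.
have mF' i : i \in (k |` J)%fset -> measurable (F' i).
  by move=> _; rewrite /F'; case: ifP.
have := ind _ kD F' mF'; rewrite big_fsetU1//= F'k.
have -> : (\prod_(i <- J) P (X i @^-1` F' i) = \prod_(i <- J) P (X i @^-1` F i))%E.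
  apply: eq_big_seq => i iJ; rewrite /F'; case: eqP => // ik.
  by rewrite ik (negbTE kJ) in iJ.
rewrite muleC => <-; congr (P _); apply/seteqP; split=> w.
  move=> [Fw Bw] i /=; rewrite in_fset1U /F'; case: eqP => [->//|_ /= iJ].
  exact: Fw.
move=> F'w; split; last by have := F'w k; rewrite /= in_fset1U eqxx F'k; exact.
move=> i /= iJ; have := F'w i; rewrite /= in_fset1U iJ orbT /F'.
by case: eqP => [ik|_]; [rewrite ik (negbTE kJ) in iJ|exact].
Qed.

End Cylinders.
End Independence.

(** * The averaged nonlinearity and the limit event *)

Section AveragedNonlinearity.
Context {d : measure_display} {T : measurableType d} {R : realType}.
Variable P : probability T R.

Lemma same_law_Rintegral (n1 n2 : {RV P >-> R}) (F : R -> R) (K : R) :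
  (forall A, measurable A -> distribution P n1 A = distribution P n2 A) ->
  measurable_fun setT F -> (forall x, `|F x| <= K) ->
  \int[P]_w F (n1 w) = \int[P]_w F (n2 w).
Proof.
move=> n12 mF FK.
have mEF : measurable_fun setT (EFin \o F) by exact/measurable_EFinP.
have iF (n : {RV P >-> R}) : P.-integrable setT ((EFin \o F) \o n).
  apply: (@bounded_fun_integrable _ _ _ _ (F \o n) K) => [|w /=]; last exact: FK.
  exact: (measurableT_comp mF).
rewrite /Rintegral; congr fine.
transitivity (\int[distribution P n1]_x (EFin \o F) x)%E.
  by rewrite (integral_distribution mEF (iF n1)).
transitivity (\int[distribution P n2]_x (EFin \o F) x)%E.
  by apply: eq_measure_integral => A mA _; exact: n12.
by rewrite (integral_distribution mEF (iF n2)).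
Qed.

Lemma averaged_nonlinearity (n : {RV P >-> R}) (f : R -> R) (K : R) :
  symmetric_law (distribution P n) -> {homo f : x y / x < y} ->
  (forall x, f (- x) = - f x) -> (forall x, `|f x| <= K) ->
  let g c := \int[P]_w f (c - n w) in
  [/\ forall c, g (- c) = - g c, {homo g : x y / x <= y},
      forall c, 0 < c -> 0 < g c & forall c, `|g c| <= K].
Proof.
move=> n_sym f_incr f_odd fK g.
have f_mono : {homo f : x y / x <= y}.
  by move=> x y; rewrite le_eqVlt => /predU1P[->//|/f_incr/ltW].
have mf : measurable_fun setT f by exact: nondecreasing_measurable.
have mfc (c : R) : measurable_fun setT (fun x : R => f (c - x)).
  by apply: (measurableT_comp mf); exact: measurable_funB.
have mfn (c : R) : measurable_fun setT (fun w => f (c - n w)) by exact: (measurableT_comp (mfc c)).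
have ifn (c : R) : P.-integrable setT (EFin \o (fun w => f (c - n w))).
  exact: bounded_fun_integrable (mfn c) (fun w => fK _).
have mN : measurable_fun setT (fun w => - n w) by exact: measurableT_comp.
have g_odd c : g (- c) = - g c.
  (* [- n] has the law of [n], and oddness of [f] carries the sign outside. *)
  pose n' : {RV P >-> R} := mfun_Sub (mem_set mN).
  have nn' A : measurable A -> distribution P n' A = distribution P n A.
    move=> mA; rewrite -(n_sym A mA); congr (P _); apply/seteqP; split=> w /=.
      by move=> Aw; exists (- n w); rewrite ?opprK.
    by move=> [x Ax <-]; rewrite opprK.
  have mfn' : measurable_fun setT (fun w => f (c - n' w)) by exact: (measurableT_comp (mfc c)).
  rewrite /g -(same_law_Rintegral nn' (mfc c) (fun x => fK _)).
  transitivity (\int[P]_w (-1 * f (c - n' w))).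
    by apply: eq_Rintegral => w _; rewrite mulN1r -f_odd /=; congr f; ring.
  by rewrite RintegralZl ?mulN1r//; exact: bounded_fun_integrable mfn' (fun w => fK _).
split=> // [x y xy|c c0|c].
- by apply: le_Rintegral => // w _; apply: f_mono; rewrite lerD2r.
- have g0 : g 0 = 0 by have := g_odd 0; rewrite oppr0; lra.
  (* [f (c - n) - f (- n)] is positive at every point, so its integral is positive. *)
  suff : 0 < g c - g 0 by rewrite g0 subr0.
  rewrite /g -RintegralB//.
  apply: (@Rintegral_gt0 _ _ _ _ _ (K + K)).
  + exact: measurable_funB.
  + by move=> w; apply: le_trans (ler_normB _ _) _; exact: lerD.
  + by move=> w; rewrite subr_gt0 f_incr// ltrD2r.
- exact: Rintegral_bounded.
Qed.

End AveragedNonlinearity.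

Section LimitEvent.
Context {d : measure_display} {T : measurableType d} {R : realType}.

Lemma cvg_col_const (N : nat) (u : nat -> 'cV[R]_N) (l : R) :
  (u @ \oo --> l *: const_mx 1) <-> (forall i, (fun t => u t i ord0) @ \oo --> l).
Proof.
split=> [ul i|ul].
  apply/cvgrPdist_lt => eps eps0; have /cvg_ballP/(_ eps eps0) := ul.
  by apply: filterS => t; rewrite /ball/= => -[_ /(_ i ord0)]; rewrite /ball/= !mxE mulr1.
apply/cvg_ballP => eps eps0.
have : \forall t \near \oo, forall i, `|l - u t i ord0| < eps.
  by apply: filter_forall => i; have /cvgrPdist_lt/(_ eps eps0) := ul i.
apply: filterS => t ut; rewrite /ball/=; split=> // i j; rewrite (ord1 j) /ball/= !mxE mulr1.
exact: ut.
Qed.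

(** Convergence holds exactly when the upper limit of the distance [u] is 0, and upper limits
    preserve measurability. *)
Lemma measurable_consensus_event (N : nat) (X : nat -> T -> 'cV[R]_N) (theta : T -> R) :
  (forall t i, measurable_fun setT (fun w => X t w i ord0)) ->
  measurable_fun setT theta ->
  measurable [set w | (fun t => X t w) @ \oo --> theta w *: const_mx 1].
Proof.
move=> mX mtheta.
pose u t w := \sum_(i < N) `|X t w i ord0 - theta w|.
have mu t : measurable_fun setT (EFin \o u t).
  apply/measurable_EFinP; apply: measurable_sum => i; apply: measurableT_comp => //.
  exact: measurable_funB.
have u0 t w : 0 <= u t w by apply: sumr_ge0.
rewrite (_ : [set w | _] = (fun w => limn_esup (fun t => (u t w)%:E)) @^-1` [set 0%E]).
  by rewrite -[X in measurable X]setTI; exact: (measurable_fun_limn_esup mu).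
apply/seteqP; split=> w /=.
  move=> /cvg_col_const Xw.
  suff /cvg_limn_einf_sup[] : (fun t => (u t w)%:E) @ \oo --> 0%E by [].
  apply: cvg_EFin; first exact: nearW.
  rewrite (_ : 0 = \sum_(i < N) 0); last by rewrite big1.
  apply: cvg_big => [|i _]; first exact: add_continuous.
  rewrite -(normr0 R) -(subrr (theta w)); apply: cvg_norm; apply: cvgB => //.
  exact: cvg_cst.
move=> uw; apply/cvg_col_const => i.
have : (fun t => (u t w)%:E) @ \oo --> 0%E.
  by apply: limn_esup_le_cvg => [|t]; rewrite ?uw// lee_fin.
move=> /fine_cvgP[_ /cvgr0Pnorm_lt/= ucvg]; apply/cvgrPdist_lt => eps eps0.
apply: filterS (ucvg eps eps0) => t; rewrite ger0_norm//; apply: le_lt_trans.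
by rewrite distrC /u (bigD1 i)//= lerDl sumr_ge0.
Qed.

End LimitEvent.

(** * The past of the noise and almost sure consensus *)

Definition past_edges (N : nat) (e : rel 'I_N) (t : nat) : {fset nat * ('I_N * 'I_N)} :=
  [fset k in allpairs pair (iota 0 t) (enum {: 'I_N * 'I_N}) | e k.2.1 k.2.2]%fset.

Lemma in_past_edges (N : nat) (e : rel 'I_N) (t : nat) (k : nat * ('I_N * 'I_N)) :
  (k \in past_edges e t) = (k.1 < t)%N && e k.2.1 k.2.2.
Proof.
rewrite /past_edges !inE/=; case: k => s p /=; congr (_ && _).
apply/allpairsP/idP => [[[s' p'] [/=]]|st].
  by rewrite mem_iota add0n => /andP[_ st] _ [-> _].
by exists (s, p); rewrite mem_iota mem_enum.
Qed.

Theorem theorem3 (R : realType) (d : measure_display) (T : measurableType d)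
    (P : probability T R)
    (N : nat) (e : rel 'I_N) (f h : R -> R)
    (n : nat * ('I_N * 'I_N) -> {RV P >-> R})
    (alpha : nat -> R) (x0 : 'cV[R]_N) (X : nat -> T -> 'cV[R]_N)
    (e_simple : simple_graph e)
    (e_connected : connected_graph e)
    (f_incr : {homo f : x y / x < y})
    (f_odd : forall x : R, f (- x) = - f x)
    (f_bounded : exists M : R, forall x : R, `|f x| <= M)
    (h_incr : {homo h : x y / x < y})
    (n_indep : mutually_independent [set k | e k.2.1 k.2.2] n)
    (n_ident : identically_distributed [set k | e k.2.1 k.2.2] n)
    (n_sym : forall k : nat * ('I_N * 'I_N), e k.2.1 k.2.2 ->
      symmetric_law (distribution P (n k)))
    (alpha_pos : forall t : nat, 0 < alpha t)
    (alpha_div : (\sum_(0 <= t <oo) (alpha t)%:E = +oo)%E)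
    (alpha_sq : (\sum_(0 <= t <oo) (alpha t ^+ 2)%:E < +oo)%E)
    (X_init : forall w : T, X 0%N w = x0)
    (X_step : forall (t : nat) (w : T) (i : 'I_N),
      X t.+1 w i ord0 = X t w i ord0 - alpha t *
        \sum_(j in neighbours e i)
          f (h (X t w i ord0) - h (X t w j ord0) - n (t, (i, j)) w)) :
  exists theta : {RV P >-> R},
    let E := [set w : T | (fun t => X t w) @ \oo --> theta w *: const_mx 1] in
    measurable E /\ P E = 1%E.
Proof.
have [e_sym _] := e_simple.
have [K fK] := f_bounded.
have f_mono : {homo f : x y / x <= y}.
  by move=> x y; rewrite le_eqVlt => /predU1P[->//|/f_incr/ltW].
have h_mono : {homo h : x y / x <= y}.
  by move=> x y; rewrite le_eqVlt => /predU1P[->//|/h_incr/ltW].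
have mf : measurable_fun setT f by exact: nondecreasing_measurable.
have mh : measurable_fun setT h by exact: nondecreasing_measurable.
have [g [[g_odd g_mono g_pos gK] gE]] : exists g : R -> R,
    [/\ forall c, g (- c) = - g c, {homo g : x y / x <= y},
      forall c, 0 < c -> 0 < g c & forall c, `|g c| <= K] /\
    forall k, e k.2.1 k.2.2 -> forall c, g c = \int[P]_w f (c - n k w).
  (* Equality of the laws lets one [g] serve all edges; in a graph without edges [f] itself is a
     valid default. *)
  have [[k0 ek0]|no_edge] := pselect (exists k : nat * ('I_N * 'I_N), e k.2.1 k.2.2).
    exists (fun c => \int[P]_w f (c - n k0 w)); split.
      exact: averaged_nonlinearity (n_sym k0 ek0) f_incr f_odd fK.
    move=> k ek c; apply: (same_law_Rintegral (F := fun x => f (c - x)) (K := K)) => //.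
      by move=> A mA; exact: n_ident.
    by apply: (measurableT_comp mf); exact: measurable_funB.
  exists f; split; last by move=> k ek; case: no_edge; exists k.
  by split=> // c c0; have := f_incr _ _ c0; have := f_odd 0; rewrite oppr0; lra.
have mg : measurable_fun setT g by exact: nondecreasing_measurable.
(* Only noise at times strictly before [t] enters: it determines [X t], while the noise at time [t]
   is independent of it. *)
pose C t := cylinders n (past_edges e t).
have C_measurable t : C t `<=` measurable by exact: cylinders_measurable.
have C_mono t : C t `<=` C t.+1.
  apply: cylinders_mono => k; rewrite !in_past_edges => /andP[kt ->].
  by rewrite andbT ltnW.
have n_adapted t i j : e i j -> adapted (C t.+1) (n (t, (i, j))).
  by move=> eij; apply: cylinders_adapted; rewrite in_past_edges/= ltnSn.
pose gap t i j w := h (X t w i ord0) - h (X t w j ord0).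
have gap_adapted t i j : (forall i, adapted (C t) (fun w => X t w i ord0)) ->
    adapted (C t) (gap t i j).
  move=> aX; apply: measurable_funB; apply: measurableT_comp => //; exact: aX.
have noise_adapted t i j : e i j -> adapted (C t) (gap t i j) ->
    adapted (C t.+1) (fun w => f (gap t i j w - n (t, (i, j)) w)).
  move=> eij agap; apply: measurableT_comp => //; apply: measurable_funB.
    exact: adapted_mono agap.
  exact: n_adapted.
have X_adapted t : forall i, adapted (C t) (fun w => X t w i ord0).
  elim: t => [|t IH] i.
    rewrite (_ : (fun w => _) = cst (x0 i ord0)); first exact: measurable_cst.
    by apply/funext => w; rewrite X_init.
  rewrite (_ : (fun w => _) = (fun w => X t w i ord0 - alpha t *
      \sum_j if j \in neighbours e i then f (gap t i j w - n (t, (i, j)) w) else 0)).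
    apply: measurable_funB; first exact: adapted_mono (IH i).
    apply: measurable_funM => //; apply: measurable_sum => j.
    case: (boolP (j \in neighbours e i)) => [|_]; last exact: measurable_cst.
    by rewrite inE => eij; apply: noise_adapted => //; exact: gap_adapted.
  by apply/funext => w; rewrite X_step big_mkcond.
pose xi i j t w := f (gap t i j w - n (t, (i, j)) w) - g (gap t i j w).
have xi_cvg i j : \forall w \ae P, e i j -> cvgn (series (fun t => alpha t * xi i j t w)).
  have [eij|_] := boolP (e i j); last by apply: aeW.
  have : \forall w \ae P, cvgn (series (fun t => alpha t * xi i j t w)).
    apply: (@mds_cvg _ T R P C C_measurable C_mono (xi i j) alpha (K + K)) => //.
    - move=> t; apply: measurable_funB; first by apply: noise_adapted => //; exact: gap_adapted.
      apply: measurableT_comp => //; apply: (adapted_mono (@C_mono t)).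
      exact: gap_adapted.
    - by move=> t w; apply: le_trans (ler_normB _ _) _; exact: lerD.
    - move=> t u M au uM.
      apply: (@indep_orth _ T R P (C t) (n (t, (i, j))) f g u (gap t i j) K M) => //.
      + move=> A B CA mB; apply: (cylinders_indep n_indep) CA => //.
          by move=> k /=; rewrite in_past_edges => /andP[].
        by rewrite in_past_edges/= ltnn.
      + exact: gE.
      + exact: gap_adapted.
  exact: filterS.
have alpha_cvg : alpha @ \oo --> 0.
  apply/cvgr0Pnorm_le => b b0.
  have a2 : (fun t => alpha t ^+ 2) @ \oo --> 0.
    by apply/cvg_series_cvg_0/nnseries_is_cvg => // t; exact: sqr_ge0.
  have /cvgr0Pnorm_le/(_ (b ^+ 2) (exprn_gt0 2 b0)) := a2.
  apply: filterS => t; rewrite normrX ler_pXn2r// nnegrE; exact: ltW.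
have all_cvg : \forall w \ae P, forall i j, e i j ->
    cvgn (series (fun t => alpha t * xi i j t w)).
  by apply: filter_forall => i; apply: filter_forall => j; exact: xi_cvg.
have X_cvg w : (forall i j, e i j -> cvgn (series (fun t => alpha t * xi i j t w))) ->
    exists l : R, forall i, (fun t => X t w i ord0) @ \oo --> l.
  move=> xiw.
  pose v t i := - \sum_(j | e i j) alpha t * xi i j t w.
  apply: (@consensus R N e g h K alpha (fun t i => X t w i ord0) v) => //.
    move=> i; rewrite (_ : series _ = (fun m =>
        - \sum_(j | e i j) series (fun t => alpha t * xi i j t w) m)).
      apply: is_cvgN; apply/cvg_ex; eexists.
      apply: cvg_big => [|j eij]; first exact: add_continuous.
      exact: xiw.
    by apply/funext => m; rewrite /series/= exchange_big/= sumrN.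
  move=> t i; rewrite X_step /v -mulr_sumr /xi sumrB.
  rewrite (eq_bigl (e i)) => [|j]; last by rewrite inE.
  by rewrite /gap; ring.
have [N0 _] := e_connected.
pose i0 := Ordinal N0.
(* An upper limit is measurable even where convergence fails; [fine] keeps it real by sending
   infinite values to 0. *)
pose theta w := fine (limn_esup (fun t => (X t w i0 ord0)%:E)).
have mX t i : measurable_fun setT (fun w => X t w i ord0).
  exact: adapted_measurable (C_measurable t) (X_adapted t i).
have mtheta : measurable_fun setT theta.
  apply: measurableT_comp => //; apply: measurable_fun_limn_esup => t.
  exact/measurable_EFinP.
exists (mfun_Sub (mem_set mtheta)); split; first exact: measurable_consensus_event.
have mE := measurable_consensus_event mX mtheta.
(* The convergence set contains the complement of a measurable null set, which gives the event full
   probability. *)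
case: all_cvg => B [mB B0 goodB].
apply/eqP; rewrite eq_le probability_le1//=.
have <- : P (~` B) = 1%E by rewrite probability_setC// B0 sube0.
apply: le_measure; rewrite ?inE//; first exact: measurableC.
move=> w nBw; have [|l Xl] := X_cvg w; first exact: contrapT (contra_not (goodB w) nBw).
apply/cvg_col_const => i /=; suff -> : theta w = l by exact: Xl.
rewrite /theta; have /cvg_limn_einf_sup[_ ->] // : (fun t => (X t w i0 ord0)%:E) @ \oo --> l%:E.
by apply: cvg_EFin; [exact: nearW|exact: Xl].
Qed.
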